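(* Let $(A,\Delta)$ be a multiplier Hopf $^*$-algebra with positive integrals, $\psi$ a positive right integral on $A$, $\mathcal H$ the Hilbert space completion of $A$ for the scalar product $\langle a',a\rangle=\psi(a^*a')$, and $\Lambda:A\to\mathcal H$ the canonical injection. The linear map $V$ defined on $\Lambda(A)\otimes\Lambda(A)$ by $$V:\Lambda(x)\otimes\Lambda(x')\mapsto\sum_{(x)}\Lambda(x_{(1)})\otimes\Lambda(x_{(2)}x')$$ is isometric. It extends to a unitary operator on the Hilbert space tensor product $\mathcal H\otimes\mathcal H$.
   Context: A multiplier Hopf $^*$-algebra $(A,\Delta)$ is a $^*$-algebra $A$ over $\mathbb C$ with non-degenerate product (possibly without unit), with multiplier algebra $M(A)$, and a coassociative $^*$-homomorphism $\Delta:A\to M(A\otimes A)$ (algebraic tensor product) such that $a\otimes a'\mapsto\Delta(a)(1\otimes a')$ and $a\otimes a'\mapsto(a\otimes1)\Delta(a')$ are bijections of $A\otimes A$ onto itself. A left (respectively right) integral is a non-zero linear functional $\varphi$ (respectively $\psi$) with $(\iota\otimes\varphi)\Delta(a)=\varphi(a)1$ (respectively $(\psi\otimes\iota)\Delta(a)=\psi(a)1$) in $M(A)$ for all $a\in A$. A functional $\omega$ is positive if $\omega(a^*a)\ge0$ for all $a$; ''with positive integrals'' means that positive left and right integrals exist. Integrals are faithful, so $\psi(a^*a)=0$ implies $a=0$. In Sweedler notation, $\sum_{(x)}x_{(1)}\otimes x_{(2)}x'$ denotes $\Delta(x)(1\otimes x')\in A\otimes A$. *)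

(* Defs.v *)
From HB Require Import structures.
From mathcomp Require Import all_boot all_order all_algebra generic_quotient.
From mathcomp Require Import complex.
From mathcomp Require Import boolp classical_sets reals topology normedtype.

Set Implicit Arguments.
Unset Strict Implicit.
Unset Printing Implicit Defensive.

Import Order.TTheory GRing.Theory Num.Theory numFieldNormedType.Exports.

Local Open Scope ring_scope.
Local Open Scope quotient_scope.

Local Obligation Tactic := idtac.

(* The algebraic tensor product: finite formal sums of pairs (as lists)       *)
(* modulo the congruence generated by the bilinearity relations.              *)
Section Tensor.
Context {K : fieldType}.

Inductive tensor_rel (A B : lmodType K) : seq (A * B) -> seq (A * B) -> Prop :=
| tensor_rel_refl s : tensor_rel s s
| tensor_rel_sym s t : tensor_rel s t -> tensor_rel t s
| tensor_rel_trans s t u : tensor_rel s t -> tensor_rel t u -> tensor_rel s u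
| tensor_rel_cat s s' t t' :
    tensor_rel s s' -> tensor_rel t t' -> tensor_rel (s ++ t) (s' ++ t')
| tensor_rel_catC s t : tensor_rel (s ++ t) (t ++ s)
| tensor_rel_0 b : tensor_rel [:: (0, b)] [::]
| tensor_rel_Dl a a' b : tensor_rel [:: (a + a', b)] [:: (a, b); (a', b)]
| tensor_rel_Dr a b b' : tensor_rel [:: (a, b + b')] [:: (a, b); (a, b')]
| tensor_rel_Z k a b : tensor_rel [:: (k *: a, b)] [:: (a, k *: b)].

Section Module.
Context {A B : lmodType K}.
Implicit Types s t u : seq (A * B).

Definition tensor_relb : rel (seq (A * B)) := fun s t => `[< tensor_rel s t >].

Lemma tensor_relb_refl : reflexive tensor_relb.
Proof. by move=> s; apply/asboolP; exact: tensor_rel_refl. Qed.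

Lemma tensor_relb_sym : symmetric tensor_relb.
Proof. by move=> s t; apply/asboolP/asboolP; exact: tensor_rel_sym. Qed.

Lemma tensor_relb_trans : transitive tensor_relb.
Proof.
move=> s t u /asboolP ts /asboolP su.
by apply/asboolP; exact: tensor_rel_trans su.
Qed.

Canonical tensor_equiv :=
  EquivRel tensor_relb tensor_relb_refl tensor_relb_sym tensor_relb_trans.

End Module.

Definition tensor (A B : lmodType K) := {eq_quot (@tensor_equiv A B)}.
HB.instance Definition _ (A B : lmodType K) := Choice.on (tensor A B).
HB.instance Definition _ (A B : lmodType K) := EqQuotient.on (tensor A B).

Section ModuleTheory.
Context {A B : lmodType K}.
Implicit Types (s t u : seq (A * B)) (x y z : tensor A B).

Definition tclass s : tensor A B := \pi_(tensor A B) s.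

Definition tens (a : A) (b : B) : tensor A B := tclass [:: (a, b)].

Lemma tclassP s t : tclass s = tclass t <-> tensor_rel s t.
Proof.
by split=> [/eqmodP/asboolP //|st]; apply/eqmodP/asboolP.
Qed.

Lemma tclass_repr x : tclass (repr x) = x.
Proof. exact: reprK. Qed.

Lemma repr_tclass s : tensor_rel (repr (tclass s)) s.
Proof. by apply/tclassP; rewrite tclass_repr. Qed.

Definition tadd x y := tclass (repr x ++ repr y).
Definition tzero := tclass [::].
Definition tscale k x := tclass [seq (k *: p.1, p.2) | p <- repr x].
Definition topp x := tscale (-1) x.

Lemma tscale_rel k s t : tensor_rel s t ->
  tensor_rel [seq (k *: p.1, p.2) | p <- s] [seq (k *: p.1, p.2) | p <- t].
Proof.
elim=> {s t} [s|s t _ IH|s t u _ st _ tu|s s' t t' _ ss' _ tt'|s t|b|a a' b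
  |a b b'|l a b] /=.
- exact: tensor_rel_refl.
- exact: tensor_rel_sym.
- exact: tensor_rel_trans tu.
- by rewrite !map_cat; exact: tensor_rel_cat.
- by rewrite !map_cat; exact: tensor_rel_catC.
- by rewrite scaler0; exact: tensor_rel_0.
- by rewrite scalerDr; exact: tensor_rel_Dl.
- exact: tensor_rel_Dr.
- by rewrite scalerA mulrC -scalerA; exact: tensor_rel_Z.
Qed.

Lemma taddE s t : tadd (tclass s) (tclass t) = tclass (s ++ t).
Proof. by apply/tclassP; apply: tensor_rel_cat; exact: repr_tclass. Qed.

Lemma tscaleE k s : tscale k (tclass s) = tclass [seq (k *: p.1, p.2) | p <- s].
Proof. by apply/tclassP; apply: tscale_rel; exact: repr_tclass. Qed.

Lemma taddA : associative tadd.
Proof.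
move=> x y z; rewrite -(tclass_repr x) -(tclass_repr y) -(tclass_repr z).
by rewrite !taddE catA.
Qed.

Lemma taddC : commutative tadd.
Proof.
move=> x y; rewrite -(tclass_repr x) -(tclass_repr y) !taddE.
by apply/tclassP; exact: tensor_rel_catC.
Qed.

Lemma tadd0 : left_id tzero tadd.
Proof. by move=> x; rewrite -(tclass_repr x) taddE. Qed.

Lemma tscaleDl x k l : tscale (k + l) x = tadd (tscale k x) (tscale l x).
Proof.
rewrite -(tclass_repr x); elim: (repr x) => [|[a b] s IH].
  by rewrite !tscaleE taddE.
have cE r : tclass ((a, b) :: s) = tadd (tens a b) (tclass s).
  by rewrite taddE.
move: IH; rewrite !tscaleE /= => IH.
rewrite -cat1s -taddE IH scalerDl.
rewrite (_ : tclass [:: (k *: a + l *: a, b)]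
           = tadd (tens (k *: a) b) (tens (l *: a) b)); last first.
  by rewrite taddE; apply/tclassP; exact: tensor_rel_Dl.
rewrite -[X in _ = tadd (tclass X) _]cat1s -[X in _ = tadd _ (tclass X)]cat1s.
rewrite -!taddE -!taddA; congr tadd.
by rewrite taddA (taddC (tens _ _)) -taddA.
Qed.

Lemma tscale0 x : tscale 0 x = tzero.
Proof.
rewrite -(tclass_repr x) tscaleE; elim: (repr x) => //= -[a b] s IH.
rewrite -cat1s -taddE IH taddE cats0 scale0r.
by apply/tclassP; exact: tensor_rel_0.
Qed.

Lemma tscale1 : left_id 1 tscale.
Proof.
move=> x; rewrite -(tclass_repr x) tscaleE; congr tclass.
by rewrite -[RHS]map_id; apply: eq_map => -[a b] /=; rewrite scale1r.
Qed.

Lemma taddN : left_inverse tzero topp tadd.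
Proof.
by move=> x; rewrite -[X in tadd _ X]tscale1 -tscaleDl addNr tscale0.
Qed.

HB.instance Definition _ :=
  GRing.isZmodule.Build (tensor A B) taddA taddC tadd0 taddN.

Lemma tscaleA k l x : tscale k (tscale l x) = tscale (k * l) x.
Proof.
rewrite -(tclass_repr x) !tscaleE -map_comp; congr tclass.
by apply: eq_map => p /=; rewrite scalerA.
Qed.

Lemma tscaleDr : right_distributive tscale +%R.
Proof.
move=> k x y; rewrite -(tclass_repr x) -(tclass_repr y).
by rewrite [_ + _]taddE !tscaleE [RHS]taddE map_cat.
Qed.

Lemma tscaleDl' x : {morph tscale^~ x : k l / k + l}.
Proof. by move=> k l; exact: tscaleDl. Qed.

HB.instance Definition _ :=
  GRing.Zmodule_isLmodule.Build K (tensor A B) tscaleA tscale1 tscaleDr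
    tscaleDl'.

(* The map induced on the tensor product by [f], additive in each variable and *)
(* balanced; without these hypotheses the value depends on the choice of       *)
(* representatives.                                                            *)
Definition tlift (V : zmodType) (f : A -> B -> V) x : V :=
  \sum_(p <- repr x) f p.1 p.2.

Definition balanced (V : zmodType) (f : A -> B -> V) : Prop :=
  [/\ forall a a' b, f (a + a') b = f a b + f a' b,
      forall a b b', f a (b + b') = f a b + f a b'
    & forall k a b, f (k *: a) b = f a (k *: b)].

Definition bilinear_map (V : lmodType K) (f : A -> B -> V) : Prop :=
  (forall b, linear (f^~ b)) /\ (forall a, linear (f a)).

Lemma bilinear_balanced (V : lmodType K) (f : A -> B -> V) :
  bilinear_map f -> balanced f.
Proof.
case=> fl fr; split=> [a a' b|a b b'|k a b].
- by have := fl b 1 a a'; rewrite !scale1r.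
- by have := fr a 1 b b'; rewrite !scale1r.
- have f0l : f 0 b = 0.
    by have /eqP := fl b 1 0 0; rewrite !scale1r addr0 -subr_eq0 opprD addNKr
         oppr_eq0 => /eqP.
  have f0r : f a 0 = 0.
    by have /eqP := fr a 1 0 0; rewrite !scale1r addr0 -subr_eq0 opprD addNKr
         oppr_eq0 => /eqP.
  have := fl b k a 0; rewrite addr0 f0l addr0 => ->.
  by have := fr a k b 0; rewrite addr0 f0r addr0 => ->.
Qed.

Lemma tlift_class (V : zmodType) (f : A -> B -> V) s : balanced f ->
  tlift f (tclass s) = \sum_(p <- s) f p.1 p.2.
Proof.
move=> [fDl fDr fZ]; rewrite /tlift.
have sum_rel u t : tensor_rel u t ->
    \sum_(p <- u) f p.1 p.2 = \sum_(p <- t) f p.1 p.2.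
  elim=> {u t} [u|u t _ //|u t v _ -> _ ->|u u' t t' _ IH _ IH'|u t|b|a a' b
    |a b b'|l a b] //.
  - by rewrite !big_cat IH IH'.
  - by rewrite !big_cat /= addrC.
  - rewrite big_seq1 big_nil /=; apply: (addrI (f 0 b)).
    by rewrite -fDl !addr0.
  - by rewrite big_seq1 big_cons big_seq1 /= fDl.
  - by rewrite big_seq1 big_cons big_seq1 /= fDr.
  - by rewrite !big_seq1 /= fZ.
exact/sum_rel/repr_tclass.
Qed.

Lemma tlift_tens (V : zmodType) (f : A -> B -> V) a b : balanced f ->
  tlift f (tens a b) = f a b.
Proof. by move=> fb; rewrite tlift_class // big_seq1. Qed.

Lemma tliftD (V : zmodType) (f : A -> B -> V) : balanced f ->
  {morph tlift f : x y / x + y}.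
Proof.
move=> fb x y; rewrite -(tclass_repr x) -(tclass_repr y) [_ + _]taddE.
by rewrite !tlift_class // big_cat.
Qed.

Lemma tlift_linear (V : lmodType K) (f : A -> B -> V) : bilinear_map f ->
  linear (tlift f).
Proof.
move=> fb k x y; have fB := bilinear_balanced fb.
rewrite tliftD //; congr (_ + _).
rewrite -(tclass_repr x) [_ *: _]tscaleE !tlift_class // big_map scaler_sumr.
apply: eq_bigr => p _ /=; have := fb.1 p.2 k p.1 0.
have -> : f 0 p.2 = 0 by apply: (addrI (f 0 p.2)); case: fB => <- *; rewrite !addr0.
by rewrite !addr0.
Qed.

Lemma tens_bilinear : bilinear_map tens.
Proof.
split=> [b k a a'|a k b b']; symmetry.
  rewrite [_ *: _]tscaleE [_ + _]taddE; apply/tclassP.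
  exact/tensor_rel_sym/tensor_rel_Dl.
rewrite [_ *: _]tscaleE [_ + _]taddE; apply/tclassP => /=.
apply: tensor_rel_sym; apply: tensor_rel_trans (tensor_rel_Dr _ _ _) _.
rewrite -cat1s -[X in tensor_rel _ X]cat1s.
apply: tensor_rel_cat (tensor_rel_refl _).
exact/tensor_rel_sym/tensor_rel_Z.
Qed.

Lemma tclass_sum s : tclass s = \sum_(p <- s) tens p.1 p.2.
Proof.
elim: s => [|[a b] s IH]; first by rewrite big_nil.
by rewrite big_cons -IH [RHS]taddE.
Qed.

Lemma tensor_ind (P : tensor A B -> Prop) :
  (forall a b, P (tens a b)) -> P 0 -> (forall x y, P x -> P y -> P (x + y)) ->
  forall x, P x.
Proof.
move=> Pt P0 PD x; rewrite -(tclass_repr x) tclass_sum.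
by elim/big_ind: _ => // p _; exact: Pt.
Qed.

End ModuleTheory.

End Tensor.

Notation "a '\ot' b" := (tens a b) (at level 40, left associativity) : ring_scope.

Section TensorMaps.
Context {K : fieldType}.

Definition tmap (A A' B B' : lmodType K) (f : A -> A') (g : B -> B') :
  tensor A B -> tensor A' B' := tlift (fun a b => f a \ot g b).

Definition tassoc (A B C : lmodType K) :
    tensor (tensor A B) C -> tensor A (tensor B C) :=
  tlift (fun x c => tlift (fun a b => a \ot (b \ot c)) x).

End TensorMaps.

(* *-algebras, not necessarily unital.                                        *)
HB.mixin Record isStarAlgebra (K : numClosedFieldType) A
    of GRing.Lmodule K A := {
  amul : A -> A -> A;
  star : A -> A;
  amulA : associative amul;
  amul_bilinear : bilinear_map amul;
  starK : involutive star;
  starD : {morph star : a b / a + b};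
  starZ : forall k a, star (k *: a) = k^* *: star a;
  starM : forall a b, star (amul a b) = amul (star b) (star a)
}.

#[short(type="starAlgType")]
HB.structure Definition StarAlgebra (K : numClosedFieldType) :=
  { A of isStarAlgebra K A & GRing.Lmodule K A }.

Notation "a ** b" := (amul a b) (at level 40, left associativity) : ring_scope.

Definition nondegenerate_product (K : numClosedFieldType) (A : starAlgType K) :
    Prop :=
  (forall a : A, (forall b, a ** b = 0) -> a = 0) /\
  (forall a : A, (forall b, b ** a = 0) -> a = 0).

Section LinearFacts.
Context {K : fieldType}.

Lemma linear_map0 (U V : lmodType K) (f : U -> V) : linear f -> f 0 = 0.
Proof.
move=> fl; apply: (addrI (f 0)).
by have := fl 1 0 0; rewrite !scale1r !addr0 => <-.
Qed.

Lemma linear_mapD (U V : lmodType K) (f : U -> V) : linear f ->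
  {morph f : x y / x + y}.
Proof. by move=> fl x y; have := fl 1 x y; rewrite !scale1r. Qed.

Lemma linear_sum_map (I : Type) (r : seq I) (U V : lmodType K)
  (F : I -> U -> V) : (forall i, linear (F i)) ->
  linear (fun x => \sum_(i <- r) F i x).
Proof.
move=> Fl k x y; rewrite scaler_sumr -big_split /=.
by apply: eq_bigr => i _; rewrite Fl.
Qed.

Lemma tens_comp_bilinear (A A' B B' : lmodType K) (f : A -> A') (g : B -> B') :
  linear f -> linear g -> bilinear_map (fun a b => f a \ot g b).
Proof.
move=> fl gl; split=> [b|a] k x y.
  by rewrite fl tens_bilinear.1.
by rewrite gl tens_bilinear.2.
Qed.

Lemma tmap_linear (A A' B B' : lmodType K) (f : A -> A') (g : B -> B') :
  linear f -> linear g -> linear (tmap f g).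
Proof. by move=> fl gl; exact/tlift_linear/tens_comp_bilinear. Qed.

Lemma tmapE (A A' B B' : lmodType K) (f : A -> A') (g : B -> B') a b :
  linear f -> linear g -> tmap f g (a \ot b) = f a \ot g b.
Proof.
by move=> fl gl; rewrite /tmap tlift_tens //;
  exact/bilinear_balanced/tens_comp_bilinear.
Qed.

Lemma tassoc_bilinear (A B C : lmodType K) : bilinear_map
  (fun (x : tensor A B) (c : C) => tlift (fun a b => a \ot (b \ot c)) x).
Proof.
split=> [c|x].
  apply: tlift_linear; split=> [b|a] k u v; first by rewrite tens_bilinear.1.
  by rewrite tens_bilinear.1 tens_bilinear.2.
by apply: linear_sum_map => p k u v; rewrite !tens_bilinear.2.
Qed.

Lemma tassocE (A B C : lmodType K) (a : A) (b : B) (c : C) :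
  tassoc (a \ot b \ot c) = a \ot (b \ot c).
Proof.
rewrite /tassoc tlift_tens; last exact/bilinear_balanced/tassoc_bilinear.
rewrite tlift_tens //; apply: bilinear_balanced.
split=> [b'|a'] k u v; first by rewrite tens_bilinear.1.
by rewrite tens_bilinear.1 tens_bilinear.2.
Qed.

End LinearFacts.

Section TensorAlgebra.
Context {K : numClosedFieldType} {A B : starAlgType K}.
Implicit Types x y z : tensor A B.

Definition tmul x y : tensor A B :=
  tlift (fun a b => tlift (fun c d => (a ** c) \ot (b ** d)) y) x.

Definition tstar x : tensor A B := tlift (fun a b => star a \ot star b) x.

Let amulDl (C : starAlgType K) (c : C) : linear (amul^~ c).
Proof. exact: amul_bilinear.1. Qed.

Let amulDr (C : starAlgType K) (c : C) : linear (amul c).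
Proof. exact: amul_bilinear.2. Qed.

Lemma tmul_bilinear : bilinear_map tmul.
Proof.
split=> [y|x]; last first.
  apply: linear_sum_map => p; apply: tlift_linear.
  by apply: tens_comp_bilinear; exact: amulDr.
apply: tlift_linear; split=> [b|a]; apply: linear_sum_map => p.
  by move=> k u v; rewrite amulDl tens_bilinear.1.
by move=> k u v; rewrite amulDl tens_bilinear.2.
Qed.

Lemma tmulE (a c : A) (b d : B) :
  tmul (a \ot b) (c \ot d) = (a ** c) \ot (b ** d).
Proof.
have cd_bil a' b' : bilinear_map (fun (c' : A) (d' : B) =>
    (a' ** c') \ot (b' ** d')) by apply: tens_comp_bilinear; exact: amulDr.
rewrite /tmul tlift_tens.
  by rewrite tlift_tens //; exact: bilinear_balanced.
apply: bilinear_balanced; split=> [b'|a']; apply: linear_sum_map => p k u v.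
  by rewrite amulDl tens_bilinear.1.
by rewrite amulDl tens_bilinear.2.
Qed.

Lemma tmul0r x : tmul x 0 = 0.
Proof. exact: linear_map0 (tmul_bilinear.2 x). Qed.

Lemma tmulr0 x : tmul 0 x = 0.
Proof. exact: (linear_map0 (tmul_bilinear.1 x)). Qed.

Lemma tmulDl x y z : tmul (x + y) z = tmul x z + tmul y z.
Proof. exact: (linear_mapD (tmul_bilinear.1 z)). Qed.

Lemma tmulDr x y z : tmul x (y + z) = tmul x y + tmul x z.
Proof. exact: linear_mapD (tmul_bilinear.2 x) _ _. Qed.

Lemma tmulA : associative tmul.
Proof.
move=> x y z; move: x; apply: tensor_ind => [a b||x x' IH IH'].
- move: y; apply: tensor_ind => [c d||y y' IH IH'].
  + move: z; apply: tensor_ind => [e f||z z' IH IH'].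
    * by rewrite !tmulE !amulA.
    * by rewrite !tmul0r.
    * by rewrite !tmulDr IH IH'.
  + by rewrite !(tmul0r, tmulr0).
  + by rewrite !(tmulDr, tmulDl) IH IH'.
- by rewrite !tmulr0.
- by rewrite !tmulDl IH IH'.
Qed.

Lemma tstar_balanced :
  balanced (fun (a : A) (b : B) => star a \ot star b).
Proof.
split=> [a a' b|a b b'|k a b].
- by rewrite starD (linear_mapD (tens_bilinear.1 _)).
- by rewrite starD (linear_mapD (tens_bilinear.2 _)).
- rewrite !starZ.
  have := tens_bilinear.1 (star b) k^* (star a) 0.
  have := tens_bilinear.2 (star a) k^* (star b) 0.
  rewrite (linear_map0 (tens_bilinear.1 _)) (linear_map0 (tens_bilinear.2 _)).
  by rewrite !addr0 => -> ->.
Qed.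

Lemma tstarE (a : A) (b : B) : tstar (a \ot b) = star a \ot star b.
Proof. by rewrite /tstar tlift_tens //; exact: tstar_balanced. Qed.

Lemma tstarD : {morph tstar : x y / x + y}.
Proof. exact: tliftD tstar_balanced. Qed.

Lemma tstar0 : tstar 0 = 0.
Proof. by apply: (addrI (tstar 0)); rewrite -tstarD !addr0. Qed.

Lemma tstarK : involutive tstar.
Proof.
apply: tensor_ind => [a b||x y IH IH'].
- by rewrite !tstarE !starK.
- by rewrite !tstar0.
- by rewrite !tstarD IH IH'.
Qed.

Lemma tstarZ k x : tstar (k *: x) = k^* *: tstar x.
Proof.
move: x; apply: tensor_ind => [a b||x y IH IH'].
- have := tens_bilinear.1 b k a 0.
  rewrite (linear_map0 (tens_bilinear.1 _)) !addr0 => <-.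
  rewrite !tstarE starZ; have := tens_bilinear.1 (star b) k^* (star a) 0.
  by rewrite (linear_map0 (tens_bilinear.1 _)) !addr0.
- by rewrite scaler0 !tstar0 scaler0.
- by rewrite scalerDr !tstarD IH IH' scalerDr.
Qed.

Lemma tstarM x y : tstar (tmul x y) = tmul (tstar y) (tstar x).
Proof.
move: x; apply: tensor_ind => [a b||x x' IH IH'].
- move: y; apply: tensor_ind => [c d||y y' IH IH'].
  + by rewrite !(tmulE, tstarE) !starM.
  + by rewrite !(tmul0r, tmulr0, tstar0).
  + by rewrite !(tmulDr, tmulDl, tstarD) IH IH'.
- by rewrite !(tmul0r, tmulr0, tstar0).
- by rewrite !(tmulDr, tmulDl, tstarD) IH IH'.
Qed.

HB.instance Definition _ := isStarAlgebra.Build K (tensor A B)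
  tmulA tmul_bilinear tstarK tstarD tstarZ tstarM.

End TensorAlgebra.

(* The multiplier algebra: a multiplier m is the pair of the maps             *)
(* b |-> m b and b |-> b m.                                                   *)
Record multiplier (K : numClosedFieldType) (A : starAlgType K) := Multiplier {
  mL : A -> A;
  mR : A -> A;
  mL_linear : linear mL;
  mR_linear : linear mR;
  mLM : forall a b, mL (a ** b) = mL a ** b;
  mRM : forall a b, mR (a ** b) = a ** mR b;
  mLR : forall a b, mR a ** b = a ** mL b
}.

HB.instance Definition _ (K : numClosedFieldType) (A : starAlgType K) :=
  gen_eqMixin (multiplier A).
HB.instance Definition _ (K : numClosedFieldType) (A : starAlgType K) :=
  gen_choiceMixin (multiplier A).

Section MultiplierAlgebra.
Context {K : numClosedFieldType} {A : starAlgType K}.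
Implicit Types (m n p : multiplier A) (a b c : A).

Lemma multiplierP m n : mL m =1 mL n -> mR m =1 mR n -> m = n.
Proof.
case: m n => [f g f1 g1 p1 q1 r1] [f' g' f2 g2 p2 q2 r2] /= /funext ff /funext gg.
by subst f' g'; f_equal; exact: Prop_irrelevance.
Qed.

Let amulDl a : {morph amul^~ a : x y / x + y}.
Proof. exact: (linear_mapD (amul_bilinear.1 a)). Qed.

Let amulDr a : {morph amul a : x y / x + y}.
Proof. exact: linear_mapD (amul_bilinear.2 a). Qed.

Let amul0l a : 0 ** a = 0.
Proof. exact: (linear_map0 (amul_bilinear.1 a)). Qed.

Let amul0r a : a ** 0 = 0.
Proof. exact: linear_map0 (amul_bilinear.2 a). Qed.

Let amulZl k a b : (k *: a) ** b = k *: (a ** b).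
Proof. by have := amul_bilinear.1 b k a 0; rewrite amul0l !addr0. Qed.

Let amulZr k a b : a ** (k *: b) = k *: (a ** b).
Proof. by have := amul_bilinear.2 a k b 0; rewrite amul0r !addr0. Qed.

Let mLD m : {morph mL m : a b / a + b}.
Proof. exact: linear_mapD (@mL_linear _ _ m). Qed.

Let mRD m : {morph mR m : a b / a + b}.
Proof. exact: linear_mapD (@mR_linear _ _ m). Qed.

Let mLZ m k a : mL m (k *: a) = k *: mL m a.
Proof.
have := @mL_linear _ _ m k a 0.
by rewrite (linear_map0 (@mL_linear _ _ m)) !addr0.
Qed.

Let mRZ m k a : mR m (k *: a) = k *: mR m a.
Proof.
have := @mR_linear _ _ m k a 0.
by rewrite (linear_map0 (@mR_linear _ _ m)) !addr0.
Qed.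

Program Definition madd m n : multiplier A :=
  @Multiplier _ _ (fun a => mL m a + mL n a) (fun a => mR m a + mR n a)
    _ _ _ _ _.
Next Obligation. by move=> m n k a b /=; rewrite !(mLD, mLZ) scalerDr addrACA. Qed.
Next Obligation. by move=> m n k a b /=; rewrite !(mRD, mRZ) scalerDr addrACA. Qed.
Next Obligation. by move=> m n a b /=; rewrite !mLM amulDl. Qed.
Next Obligation. by move=> m n a b /=; rewrite !mRM amulDr. Qed.
Next Obligation. by move=> m n a b /=; rewrite amulDl amulDr !mLR. Qed.

Program Definition mscale k m : multiplier A :=
  @Multiplier _ _ (fun a => k *: mL m a) (fun a => k *: mR m a) _ _ _ _ _.
Next Obligation.
by move=> k m l a b /=; rewrite !(mLD, mLZ) scalerDr !scalerA mulrC.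
Qed.
Next Obligation.
by move=> k m l a b /=; rewrite !(mRD, mRZ) scalerDr !scalerA mulrC.
Qed.
Next Obligation. by move=> k m a b /=; rewrite mLM amulZl. Qed.
Next Obligation. by move=> k m a b /=; rewrite mRM amulZr. Qed.
Next Obligation. by move=> k m a b /=; rewrite amulZl amulZr mLR. Qed.

Program Definition mzero : multiplier A :=
  @Multiplier _ _ (fun=> 0) (fun=> 0) _ _ _ _ _.
Next Obligation. by move=> k a b /=; rewrite scaler0 addr0. Qed.
Next Obligation. by move=> k a b /=; rewrite scaler0 addr0. Qed.
Next Obligation. by move=> a b /=; rewrite amul0l. Qed.
Next Obligation. by move=> a b /=; rewrite amul0r. Qed.
Next Obligation. by move=> a b /=; rewrite amul0l amul0r. Qed.

Program Definition mone : multiplier A :=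
  @Multiplier _ _ id id _ _ _ _ _.
Next Obligation. by []. Qed.
Next Obligation. by []. Qed.
Next Obligation. by []. Qed.
Next Obligation. by []. Qed.
Next Obligation. by []. Qed.

Program Definition mmul m n : multiplier A :=
  @Multiplier _ _ (fun a => mL m (mL n a)) (fun a => mR n (mR m a)) _ _ _ _ _.
Next Obligation. by move=> m n k a b /=; rewrite !(mLD, mLZ). Qed.
Next Obligation. by move=> m n k a b /=; rewrite !(mRD, mRZ). Qed.
Next Obligation. by move=> m n a b /=; rewrite !mLM. Qed.
Next Obligation. by move=> m n a b /=; rewrite !mRM. Qed.
Next Obligation. by move=> m n a b /=; rewrite !mLR. Qed.

Program Definition mstar m : multiplier A :=
  @Multiplier _ _ (fun a => star (mR m (star a))) (fun a => star (mL m (star a)))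
    _ _ _ _ _.
Next Obligation.
by move=> m k a b /=; rewrite !(starD, starZ, mRD, mRZ) conjCK.
Qed.
Next Obligation.
by move=> m k a b /=; rewrite !(starD, starZ, mLD, mLZ) conjCK.
Qed.
Next Obligation. by move=> m a b /=; rewrite starM mRM starM starK. Qed.
Next Obligation. by move=> m a b /=; rewrite starM mLM starM starK. Qed.
Next Obligation.
by move=> m a b /=; apply: (can_inj starK); rewrite !starM !starK mLR.
Qed.

Lemma maddA : associative madd.
Proof. by move=> m n p; apply: multiplierP => a /=; rewrite addrA. Qed.

Lemma maddC : commutative madd.
Proof. by move=> m n; apply: multiplierP => a /=; rewrite addrC. Qed.

Lemma madd0 : left_id mzero madd.
Proof. by move=> m; apply: multiplierP => a /=; rewrite add0r. Qed.

Lemma maddN : left_inverse mzero (mscale (-1)) madd.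
Proof. by move=> m; apply: multiplierP => a /=; rewrite scaleN1r addNr. Qed.

HB.instance Definition _ :=
  GRing.isZmodule.Build (multiplier A) maddA maddC madd0 maddN.

Lemma mscaleA k l m : mscale k (mscale l m) = mscale (k * l) m.
Proof. by apply: multiplierP => a /=; rewrite scalerA. Qed.

Lemma mscale1 : left_id 1 mscale.
Proof. by move=> m; apply: multiplierP => a /=; rewrite scale1r. Qed.

Lemma mscaleDr : right_distributive mscale +%R.
Proof. by move=> k m n; apply: multiplierP => a /=; rewrite scalerDr. Qed.

Lemma mscaleDl m : {morph mscale^~ m : k l / k + l}.
Proof. by move=> k l; apply: multiplierP => a /=; rewrite scalerDl. Qed.

HB.instance Definition _ := GRing.Zmodule_isLmodule.Build K (multiplier A)
  mscaleA mscale1 mscaleDr mscaleDl.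

Lemma mmulA : associative mmul.
Proof. by move=> m n p; apply: multiplierP. Qed.

Lemma mmul_bilinear : bilinear_map mmul.
Proof.
by split=> [n k m m'|m k n n']; apply: multiplierP => a /=;
  rewrite ?(mRD, mRZ, mLD, mLZ).
Qed.

Lemma mstarK : involutive mstar.
Proof. by move=> m; apply: multiplierP => a /=; rewrite !starK. Qed.

Lemma mstarD : {morph mstar : m n / m + n}.
Proof. by move=> m n; apply: multiplierP => a /=; rewrite starD. Qed.

Lemma mstarZ k m : mstar (k *: m) = k^* *: mstar m.
Proof. by apply: multiplierP => a /=; rewrite starZ. Qed.

Lemma mstarM m n : mstar (mmul m n) = mmul (mstar n) (mstar m).
Proof. by apply: multiplierP => a /=; rewrite !starK. Qed.

HB.instance Definition _ := isStarAlgebra.Build K (multiplier A)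
  mmulA mmul_bilinear mstarK mstarD mstarZ mstarM.

Program Definition membed a : multiplier A :=
  @Multiplier _ _ (amul a) (amul^~ a) _ _ _ _ _.
Next Obligation. by move=> a /=; exact: amul_bilinear.2. Qed.
Next Obligation. by move=> a /=; exact: (amul_bilinear.1 a). Qed.
Next Obligation. by move=> a b c /=; rewrite amulA. Qed.
Next Obligation. by move=> a b c /=; rewrite amulA. Qed.
Next Obligation. by move=> a b c /=; rewrite amulA. Qed.

End MultiplierAlgebra.

Section MultiplierTensor.
Context {K : numClosedFieldType} {A B : starAlgType K}.
Implicit Types (m : multiplier A) (n : multiplier B).

Let tmap0 (f : A -> A) (g : B -> B) : linear f -> linear g -> tmap f g 0 = 0.
Proof. by move=> fl gl; exact/linear_map0/tmap_linear. Qed.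

Let tmapD (f : A -> A) (g : B -> B) : linear f -> linear g ->
  {morph tmap f g : x y / x + y}.
Proof. by move=> fl gl; exact/linear_mapD/tmap_linear. Qed.

(* m (x) n as a multiplier of the tensor product algebra. *)
Program Definition mtens m n : multiplier (tensor A B) :=
  @Multiplier _ _ (tmap (mL m) (mL n)) (tmap (mR m) (mR n)) _ _ _ _ _.
Next Obligation. by move=> m n /=; apply: tmap_linear; exact: mL_linear. Qed.
Next Obligation. by move=> m n /=; apply: tmap_linear; exact: mR_linear. Qed.
Next Obligation.
move=> m n; have lm := @mL_linear _ _ m; have ln := @mL_linear _ _ n.
apply: tensor_ind => [a b||x x' IH IH'] y.
- move: y; apply: tensor_ind => [c d||y y' IH IH'].
  + by rewrite [_ ** _]tmulE !tmapE // [RHS]tmulE !mLM.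
  + by rewrite ![_ ** 0]tmul0r tmap0.
  + by rewrite ![_ ** (_ + _)]tmulDr tmapD // IH IH'.
- by rewrite [0 ** _]tmulr0 tmap0 // [0 ** _]tmulr0.
- by rewrite ![(_ + _) ** _]tmulDl !tmapD // ![(_ + _) ** _]tmulDl IH IH'.
Qed.
Next Obligation.
move=> m n; have lm := @mR_linear _ _ m; have ln := @mR_linear _ _ n.
apply: tensor_ind => [a b||x x' IH IH'] y.
- move: y; apply: tensor_ind => [c d||y y' IH IH'].
  + by rewrite [_ ** _]tmulE !tmapE // [RHS]tmulE !mRM.
  + by rewrite [_ ** 0]tmul0r tmap0 // [_ ** 0]tmul0r.
  + by rewrite [_ ** (_ + _)]tmulDr !tmapD // [_ ** (_ + _)]tmulDr IH IH'.
- by rewrite ![0 ** _]tmulr0 tmap0.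
- by rewrite ![(_ + _) ** _]tmulDl tmapD // IH IH'.
Qed.
Next Obligation.
move=> m n; have lm := @mR_linear _ _ m; have ln := @mR_linear _ _ n.
have lm' := @mL_linear _ _ m; have ln' := @mL_linear _ _ n.
apply: tensor_ind => [a b||x x' IH IH'] y.
- move: y; apply: tensor_ind => [c d||y y' IH IH'].
  + by rewrite !tmapE // [LHS]tmulE [RHS]tmulE !mLR.
  + by rewrite tmap0 // ![_ ** 0]tmul0r.
  + by rewrite tmapD // ![_ ** (_ + _)]tmulDr; congr (_ + _).
- by rewrite tmap0 // ![0 ** _]tmulr0.
- rewrite tmapD // ![(_ + _) ** _]tmulDl.
  exact: (congr2 +%R (IH y) (IH' y)).
Qed.

End MultiplierTensor.

(* Multiplier Hopf *-algebras. [canL] and [canR] are the maps                 *)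
(* a (x) b |-> Delta(a)(1 (x) b) and a (x) b |-> (a (x) 1)Delta(b); they are   *)
(* determined by Delta because the product of A (x) A is non-degenerate.      *)
(* Coassociativity is Van Daele's axiom                                       *)
(*   (a (x) 1 (x) 1)(Delta (x) id)(Delta(b)(1 (x) c))                         *)
(*     = (id (x) Delta)((a (x) 1)Delta(b))(1 (x) 1 (x) c),                    *)
(* which gives meaning to (Delta (x) id)Delta = (id (x) Delta)Delta without   *)
(* extending the two maps to the multiplier algebra.                          *)
Record multHopf (K : numClosedFieldType) (A : starAlgType K) := MultHopf {
  mhopf_nondegenerate : nondegenerate_product A;
  comul : A -> multiplier (tensor A A);
  comul_linear : linear comul;
  comulM : forall a b, comul (a ** b) = comul a ** comul b;
  comul_star : forall a, comul (star a) = star (comul a);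
  canL : tensor A A -> tensor A A;
  canR : tensor A A -> tensor A A;
  canL_linear : linear canL;
  canR_linear : linear canR;
  canLE : forall a b,
    membed (canL (a \ot b)) = comul a ** mtens mone (membed b);
  canRE : forall a b,
    membed (canR (a \ot b)) = mtens (membed a) mone ** comul b;
  canL_bij : bijective canL;
  canR_bij : bijective canR;
  comulA : forall a b c,
    tassoc (tmap (fun p => canR (a \ot p)) id (canL (b \ot c)))
    = tmap id (fun q => canL (q \ot c)) (canR (a \ot b))
}.

Section Integrals.
Context {K : numClosedFieldType} {A : starAlgType K}.
Implicit Types (f : {scalar A}) (X : multiplier (tensor A A)).
Implicit Types (m : multiplier A).

Definition positive_functional f : Prop := forall a, 0 <= f (star a ** a).

Definition slice_r f : tensor A A -> A := tlift (fun a b => f b *: a).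
Definition slice_l f : tensor A A -> A := tlift (fun a b => f a *: b).

(* (id (x) f)(X) = m in M(A), where (id (x) f)(X) is the multiplier given by  *)
(*   (id (x) f)(X) b = (id (x) f)(X(b (x) 1)),                                *)
(*   b (id (x) f)(X) = (id (x) f)((b (x) 1)X),                                *)
(* for X such that X(b (x) 1) and (b (x) 1)X belong to A (x) A.               *)
Definition mslice_r f X m : Prop := forall b,
  (exists2 t, membed t = X ** mtens (membed b) mone & slice_r f t = mL m b) /\
  (exists2 t, membed t = mtens (membed b) mone ** X & slice_r f t = mR m b).

(* (f (x) id)(X) = m in M(A), with 1 (x) b in place of b (x) 1.               *)
Definition mslice_l f X m : Prop := forall b,
  (exists2 t, membed t = X ** mtens mone (membed b) & slice_l f t = mL m b) /\
  (exists2 t, membed t = mtens mone (membed b) ** X & slice_l f t = mR m b).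

Definition left_integral (G : multHopf A) f : Prop :=
  (exists a, f a != 0) /\ forall a, mslice_r f (comul G a) (f a *: mone).

Definition right_integral (G : multHopf A) f : Prop :=
  (exists a, f a != 0) /\ forall a, mslice_l f (comul G a) (f a *: mone).

End Integrals.

(* Hilbert spaces; the inner product is linear in its first variable.         *)
HB.mixin Record hasInner (R : realType) H of CompleteNormedModule R[i] H := {
  inner : {dot H for Num.conj};
  normE_inner : forall x : H, `|x| ^+ 2 = inner x x
}.

#[short(type="hilbertType")]
HB.structure Definition Hilbert (R : realType) :=
  { H of hasInner R H & CompleteNormedModule R[i] H }.

Section HilbertSpaces.
Context {R : realType}.

Definition unitary (H : hilbertType R) (U : H -> H) : Prop :=
  [/\ linear U, forall x y, inner (U x) (U y) = inner x y
    & forall y, exists x, U x = y].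

(* H is the Hilbert space completion of A for <a', a> = f(a^* a'), with       *)
(* canonical map Lam.                                                         *)
Record is_completion (A : starAlgType R[i]) (f : {scalar A})
    (H : hilbertType R) (Lam : A -> H) : Prop := IsCompletion {
  completion_linear : linear Lam;
  completion_inner : forall a' a, inner (Lam a') (Lam a) = f (star a ** a');
  completion_dense : dense (range Lam)
}.

(* HH is the Hilbert space tensor product of H1 and H2, with elementary       *)
(* tensors ot x y; the range of [tlift ot] is the span of these.              *)
Record is_hilbert_tensor (H1 H2 HH : hilbertType R) (ot : H1 -> H2 -> HH) :
    Prop := IsHilbertTensor {
  hilbert_tensor_bilinear : bilinear_map ot;
  hilbert_tensor_inner : forall x x' y y',
    inner (ot x y) (ot x' y') = inner x x' * inner y y';
  hilbert_tensor_dense : dense (range (tlift ot))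
}.

Section RightRegular.
Context {A : starAlgType R[i]} (G : multHopf A).
Context {H HH : hilbertType R} (Lam : A -> H) (ot : H -> H -> HH).

(* Lam (x) Lam on A (x) A, with values in the Hilbert space tensor product.   *)
Definition Lam2 : tensor A A -> HH := tlift (fun x x' => ot (Lam x) (Lam x')).

(* Lam(A) (x) Lam(A) as a subspace of HH. *)
Definition dom_V : set HH := range Lam2.

(* Only the values of V on dom_V matter. *)
Definition is_V (V : HH -> HH) : Prop :=
  (forall k u v, dom_V u -> dom_V v -> V (k *: u + v) = k *: V u + V v) /\
  (forall x x', V (ot (Lam x) (Lam x')) = Lam2 (canL G (x \ot x'))).

End RightRegular.

End HilbertSpaces.

(* Main.v *)
Require Import Defs.
From HB Require Import structures.
From mathcomp Require Import all_boot all_order all_algebra.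
From mathcomp Require Import complex.
From mathcomp Require Import boolp classical_sets reals topology normedtype.

(** Formally, T(a (x) b)^* T(c (x) d) = (1 (x) b^* )Delta(a^* c)(1 (x) d) for
    T(a (x) b) = Delta(a)(1 (x) b), so that right invariance of psi gives
    (psi (x) id)(T(a (x) b)^* T(c (x) d)) = psi(a^* c) b^* d, and applying psi
    shows that V is isometric.  T maps A (x) A onto itself, so V maps the dense
    subspace Lam(A) (x) Lam(A) onto itself.  The closure of the graph of V is
    then the graph of a unitary: it is symmetric in V and its inverse.

    Right invariance only speaks of elements of A (x) A as multipliers of
    A (x) A; passing to the elements themselves requires functionals on A
    that separate points, obtained by Zorn's lemma. *)

Set Implicit Arguments.
Unset Strict Implicit.
Unset Printing Implicit Defensive.

Import Order.TTheory GRing.Theory Num.Theory numFieldNormedType.Exports.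

Local Open Scope classical_set_scope.
Local Open Scope ring_scope.

(** * Linear functionals separate points *)

Section SeparatingFunctional.
Context {K : fieldType} {V : lmodType K}.

Let avoiding (v : V) : set (set V) := [set S : set V | ~ S v /\
  forall k x y, S x -> S y -> S (k *: x + y)].

Lemma maximal_subspace_avoiding (v : V) : v != 0 -> exists S : set V,
  [/\ S 0, ~ S v, forall k x y, S x -> S y -> S (k *: x + y)
    & forall x, exists k, S (x - k *: v)].
Proof.
move=> v0.
have [F FP tF|S [[Sv Slin] Smax]] := @Zorn_bigcup V (avoiding v).
  split=> [[X FX Xv]|k x y [X FX Xx] [Y FY Yy]]; first exact: (FP X FX).1 Xv.
  by have [XY|YX] := tF X Y FX FY; [exists Y => //; apply: (FP Y FY).2 => //;
    exact: XY|exists X => //; apply: (FP X FX).2 => //; exact: YX].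
pose S0 := S `|` [set 0].
have S0lin k x y : S0 x -> S0 y -> S0 (k *: x + y).
  move=> [Sx|->] [Sy|->]; rewrite ?scaler0 ?add0r ?addr0; [left; exact: Slin|
    left|by left|by right].
  rewrite -[k *: x]addr0 -(addNr x) -[- x]scaleN1r.
  by apply: (Slin) => //; exact: Slin.
(* The sum of [S0] and the line of [w] properly contains [S], so by maximality it contains [v]. *)
have extend w : ~ S w -> exists s k, S0 s /\ v = s + k *: w.
  move=> Sw; apply: contrapT => Nv.
  apply: (Smax [set z | exists s k, S0 s /\ z = s + k *: w]).
    split=> [z Sz|/(_ w) BS].
      by exists z, 0; split; [left|rewrite scale0r addr0].
    apply: Sw; apply: BS; exists 0, 1.
    by split; [right|rewrite scale1r add0r].
  split=> // k x y [s [l [Ss ->]]] [s' [l' [Ss' ->]]].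
  exists (k *: s + s'), (k * l + l'); split; first exact: S0lin.
  by rewrite scalerDr scalerDl scalerA addrACA.
have S00 : S 0.
  apply: contrapT => /extend [s [k [Ss vE]]]; move: Sv v0.
  by rewrite vE scaler0 addr0; case: Ss => [//|->] _ /eqP.
have S0S x : S0 x -> S x by case=> [//|->].
exists S; split=> // x.
have [Sx|/extend [s [k [/S0S Ss vE]]]] := pselect (S x).
  by exists 0; rewrite scale0r subr0.
have k0 : k != 0 by apply/eqP => k0; apply: Sv; rewrite vE k0 scale0r addr0.
(* From [v = s + k *: x], the vector [x - k^-1 *: v] is [- k^-1 *: s]. *)
exists k^-1; rewrite vE scalerDr scalerA mulVf// scale1r opprD addrCA subrr.
by rewrite -scaleNr; exact: Slin.
Qed.

(** The line of [v] is a complement of a maximal subspace avoiding [v]; [f] is the coordinate along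
    [v]. *)
Lemma separating_functional (v : V) : v != 0 ->
  exists2 f : V -> K, scalar f & f v = 1.
Proof.
move=> v0; have [S [S0 Sv Slin Sall]] := maximal_subspace_avoiding v0.
have uniq x k l : S (x - k *: v) -> S (x - l *: v) -> k = l.
  move=> Sk Sl; apply/eqP; rewrite -subr_eq0; apply/eqP; apply: contrapT.
  move=> /eqP kl; apply: Sv.
  (* Two distinct coefficients would put [v] in [S]: the inner sum is [(k - l) *: v]. *)
  have : S ((k - l)^-1 *: (-1 *: (x - k *: v) + (x - l *: v)) + 0).
    by apply: (Slin) => //; exact: Slin.
  rewrite addr0 scaleN1r opprB addrA addrNK -scalerBl scalerA.
  by rewrite mulVf // scale1r.
have [f fE] := choice Sall; exists f => [k x y|].
  apply: (uniq (k *: x + y)) => //.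
  have -> : k *: x + y - (k * f x + f y) *: v =
      k *: (x - f x *: v) + (y - f y *: v).
    by rewrite scalerDl scalerBr scalerA opprD addrACA.
  exact: Slin.
by apply: (uniq v) => //; rewrite scale1r subrr.
Qed.

Lemma scalar_eq0 (v : V) : (forall f : {scalar V}, f v = 0) -> v = 0.
Proof.
move=> fv; apply/eqP; apply: contrapT => /negP v0.
have [f flin f1] := separating_functional v0.
pose F : {scalar V} := HB.pack f (GRing.isLinear.Build K V K _ f flin).
by have /eqP := fv F; rewrite /F /= f1 oner_eq0.
Qed.

End SeparatingFunctional.

Lemma linear_mapB (K : fieldType) (U V : lmodType K) (f : U -> V) : linear f ->
  {morph f : x y / x - y}.
Proof.
by move=> fl x y; rewrite addrC -[- y]scaleN1r fl scaleN1r addrC.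
Qed.

Lemma linear_mapZ (K : fieldType) (U V : lmodType K) (f : U -> V) : linear f ->
  forall k, {morph f : x / k *: x}.
Proof.
by move=> fl k x; have := fl k x 0; rewrite (linear_map0 fl) !addr0.
Qed.

(** * Slices of tensors and of the multipliers they define *)

Section TensorSlices.
Context {K : numClosedFieldType} {A : starAlgType K}.
Implicit Types (f g : {scalar A}) (t u : tensor A A).

Lemma linear_comp (U V W : lmodType K) (F : V -> W) (G : U -> V) :
  linear F -> linear G -> linear (fun x => F (G x)).
Proof. by move=> Fl Gl k x y; rewrite Gl Fl. Qed.

Lemma tensor_linear_eq (B C W : lmodType K) (F G : tensor B C -> W) :
  linear F -> linear G -> (forall b c, F (b \ot c) = G (b \ot c)) -> F =1 G.
Proof.
move=> Fl Gl FG; apply: tensor_ind => [//||x y IHx IHy].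
  by rewrite (linear_map0 Fl) (linear_map0 Gl).
by rewrite (linear_mapD Fl) (linear_mapD Gl) IHx IHy.
Qed.

Lemma slice_l_bilinear f : bilinear_map (fun a b : A => f a *: b).
Proof.
split=> [b k a a'|a k b b']; first by rewrite linearP scalerDl scalerA.
by rewrite scalerDr !scalerA mulrC.
Qed.

Lemma slice_r_bilinear f : bilinear_map (fun a b : A => f b *: a).
Proof.
split=> [b k a a'|a k b b']; last by rewrite linearP scalerDl scalerA.
by rewrite scalerDr !scalerA mulrC.
Qed.

Lemma slice_l_linear f : linear (slice_l f).
Proof. exact/tlift_linear/slice_l_bilinear. Qed.

Lemma slice_r_linear f : linear (slice_r f).
Proof. exact/tlift_linear/slice_r_bilinear. Qed.

Lemma slice_lE f (a b : A) : slice_l f (a \ot b) = f a *: b.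
Proof. exact/tlift_tens/bilinear_balanced/slice_l_bilinear. Qed.

Lemma slice_rE f (a b : A) : slice_r f (a \ot b) = f b *: a.
Proof. exact/tlift_tens/bilinear_balanced/slice_r_bilinear. Qed.

(** Both sides are the value of f (x) g at [t]. *)
Lemma slice_exchange f g t : f (slice_r g t) = g (slice_l f t).
Proof.
move: t; apply: (@tensor_linear_eq _ _ K^o).
- apply: (@linear_comp _ _ K^o f); [exact: linearP|exact: slice_r_linear].
- apply: (@linear_comp _ _ K^o g); [exact: linearP|exact: slice_l_linear].
- by move=> a b; rewrite slice_rE slice_lE !linearZ /= mulrC.
Qed.

Lemma amulr_linear (B : starAlgType K) (b : B) : linear (amul^~ b).
Proof. exact: amul_bilinear.1. Qed.

Lemma amull_linear (B : starAlgType K) (b : B) : linear (amul b).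
Proof. exact: amul_bilinear.2. Qed.

Lemma tmap_amulr_linear (p : A) : linear (@tmap _ A A A A (amul^~ p) id).
Proof. by apply: tmap_linear => //; exact: amulr_linear. Qed.

Lemma slice_l_mulr f (p q : A) t :
  slice_l f (tmap (amul^~ p) id t) ** q = slice_l f (t ** (p \ot q)).
Proof.
move: t; apply: tensor_linear_eq.
- apply: (linear_comp (amulr_linear q)).
  exact: (linear_comp (slice_l_linear f) (tmap_amulr_linear p)).
- exact: (linear_comp (slice_l_linear f) (amulr_linear _)).
- move=> a b; rewrite [_ ** (_ \ot _)]tmulE tmapE//; last exact: amulr_linear.
  by rewrite !slice_lE (linear_mapZ (amulr_linear _)).
Qed.

Lemma slice_r_mulr f (p : A) t :
  slice_r f (tmap (amul^~ p) id t) = slice_r f t ** p.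
Proof.
move: t; apply: tensor_linear_eq.
- exact: (linear_comp (slice_r_linear f) (tmap_amulr_linear p)).
- exact: (linear_comp (amulr_linear _) (slice_r_linear f)).
- move=> a b; rewrite tmapE//; last exact: amulr_linear.
  by rewrite !slice_rE (linear_mapZ (amulr_linear _)).
Qed.

(** Nondegeneracy is used one leg at a time. Cancelling q in t(p (x) q) kills the left slices of t(p
    (x) 1); [slice_exchange] turns this into [slice_r g t ** p = 0], and cancelling p kills the
    right slices of [t], hence, by exchange again, its left ones. *)
Lemma slice_l_annihilator f t : nondegenerate_product A ->
  (forall u, t ** u = 0) -> slice_l f t = 0.
Proof.
move=> [nd _] t0.
have slice0 h p : slice_l h (tmap (amul^~ p) id t) = 0.
  apply: nd => q; rewrite slice_l_mulr t0.
  exact: linear_map0 (slice_l_linear h).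
apply: scalar_eq0 => g; rewrite -slice_exchange.
suff -> : slice_r g t = 0 by rewrite linear0.
apply: nd => p; apply: scalar_eq0 => h.
by rewrite -slice_r_mulr slice_exchange slice0 linear0.
Qed.

(** The axioms for [canL] and for integrals determine elements of A (x) A only as multipliers; this
    allows slicing them all the same. *)
Lemma slice_l_membed f t u : nondegenerate_product A ->
  membed t = membed u -> slice_l f t = slice_l f u.
Proof.
move=> nd /(congr1 (fun m => mL m))/= tu; apply/eqP; rewrite -subr_eq0.
rewrite -(linear_mapB (slice_l_linear f)).
apply/eqP/slice_l_annihilator => // v.
by rewrite (linear_mapB (amulr_linear v)) (congr1 (@^~ v) tu) subrr.
Qed.

Lemma membedM (B : starAlgType K) (b c : B) :
  membed (b ** c) = membed b ** membed c.
Proof. by apply: multiplierP => d /=; rewrite ?amulA. Qed.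

Lemma membed_star (B : starAlgType K) (b : B) :
  membed (star b) = star (membed b).
Proof. by apply: multiplierP => d /=; rewrite starM starK. Qed.

(** The image of [B] is a left ideal of its multiplier algebra. *)
Lemma mul_membed (B : starAlgType K) (m : multiplier B) (b : B) :
  m ** membed b = membed (mL m b).
Proof. by apply: multiplierP => d /=; rewrite ?mLM ?mLR. Qed.

Lemma star_mtens1 (b : A) :
  star (mtens (mone : multiplier A) (membed b)) = mtens mone (membed (star b)).
Proof.
apply: multiplierP => /=; apply: tensor_ind => [a d||x y IHx IHy].
- rewrite tmapE //; last exact: amull_linear.
  rewrite [star (_ \ot _)]tstarE tmapE//; last exact: amulr_linear.
  by rewrite [star _]tstarE starM !starK.
- rewrite [star 0]tstar0 (linear_map0 (tmap_linear _ _))//; last exact: amulr_linear.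
  rewrite [star 0]tstar0 (linear_map0 (tmap_linear _ _))//.
  exact: amull_linear.
- rewrite starD (linear_mapD (tmap_linear _ _))//; last exact: amulr_linear.
  rewrite starD IHx IHy (linear_mapD (tmap_linear _ _))//.
  exact: amull_linear.
- rewrite tmapE //; last exact: amulr_linear.
  rewrite [star (_ \ot _)]tstarE tmapE//; last exact: amull_linear.
  by rewrite [star _]tstarE starM !starK.
- rewrite [star 0]tstar0 (linear_map0 (tmap_linear _ _))//; last exact: amull_linear.
  rewrite [star 0]tstar0 (linear_map0 (tmap_linear _ _))//.
  exact: amulr_linear.
- rewrite starD (linear_mapD (tmap_linear _ _))//; last exact: amull_linear.
  rewrite starD IHx IHy (linear_mapD (tmap_linear _ _))//.
  exact: amulr_linear.
Qed.

Lemma slice_l_mull f (b : A) t :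
  slice_l f (mL (mtens mone (membed b)) t) = b ** slice_l f t.
Proof.
move: t; apply: tensor_linear_eq.
- exact: (linear_comp (slice_l_linear f) (@mL_linear _ _ _)).
- exact: (linear_comp (amull_linear _) (slice_l_linear f)).
- move=> a c /=; rewrite tmapE//; last exact: amull_linear.
  by rewrite !slice_lE (linear_mapZ (amull_linear _)).
Qed.

End TensorSlices.

(** * Right invariance in terms of [canL] *)

Section RightInvariance.
Context {K : numClosedFieldType} {A : starAlgType K} (G : multHopf A).
Context (psi : {scalar A}) (psi_int : right_integral G psi).

Lemma slice_canL (a b : A) : slice_l psi (canL G (a \ot b)) = psi a *: b.
Proof.
have [[t tE tE'] _] := psi_int.2 a b.
by rewrite (slice_l_membed (u := t) psi (mhopf_nondegenerate G)) ?canLE.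
Qed.

Lemma slice_star_canL (a b c d : A) :
  slice_l psi (star (canL G (a \ot b)) ** canL G (c \ot d)) =
  star b ** (psi (star a ** c) *: d).
Proof.
(* The right-hand side becomes the slice of (1 (x) [star b]) [canL G ((star a ** c) \ot d)], so only
   an identity of multipliers remains. *)
rewrite -slice_canL -slice_l_mull; apply: slice_l_membed.
  exact: mhopf_nondegenerate G.
rewrite membedM membed_star !canLE -mul_membed canLE starM star_mtens1.
by rewrite comulM comul_star !amulA.
Qed.

End RightInvariance.

(** * Closure of the graph of an isometric correspondence *)

Section ClosedGraph.
Context {K : numFieldType} {W : lmodType K} {E : completeNormedModType K}.
Implicit Types (L : W -> E).

Lemma dense_rangeP (T : Type) (f : T -> E) : dense (range f) <->
  forall y (e : K), 0 < e -> exists w, `|y - f w| < e.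
Proof.
split=> [fd y e e0|fd O [y Oy] oO].
  have [||z [+ [w _ wz]]] := fd (ball y e).
  - by exists y; exact: ballxx.
  - exact: ball_open.
  - by rewrite -ball_normE -wz; exists w.
have /nbhs_ballP[e /= e0 yeO] := open_nbhs_nbhs (conj oO Oy).
have [w fw] := fd y e e0; exists (f w); split; last by exists w.
by apply: yeO; rewrite -ball_normE.
Qed.

(** The closure of the set of pairs [(L w, L' w)]; parametrizing by [w] keeps it meaningful when [L]
    is not injective. *)
Definition graph_closure L L' (y z : E) :=
  forall e : K, 0 < e -> exists w, `|y - L w| < e /\ `|z - L' w| < e.

Lemma graph_closure_sym L L' y z :
  graph_closure L L' y z -> graph_closure L' L z y.
Proof. by move=> yz e /yz[w []]; exists w. Qed.

Lemma graph_closure_id L L' w : graph_closure L L' (L w) (L' w).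
Proof. by move=> e e0; exists w; rewrite !subrr normr0. Qed.

Lemma graph_closure_lin L L' k y y' z z' : linear L -> linear L' ->
  graph_closure L L' y z -> graph_closure L L' y' z' ->
  graph_closure L L' (k *: y + y') (k *: z + z').
Proof.
move=> Ll L'l yz yz' e e0.
have k0 : 0 < `|k| + 1 by rewrite ltr_wpDl.
have e20 : 0 < e / 2 by rewrite divr_gt0.
(* Adding 1 to the norm of [k] covers the case [k = 0]. *)
have [w [yw zw]] := yz (e / 2 / (`|k| + 1)) (divr_gt0 e20 k0).
have [w' [yw' zw']] := yz' (e / 2) e20.
have est (x x' u u' : E) : `|x - u| < e / 2 / (`|k| + 1) ->
    `|x' - u'| < e / 2 -> `|(k *: x + x') - (k *: u + u')| < e.
  move=> xu xu'; have -> : k *: x + x' - (k *: u + u') = k *: (x - u) + (x' - u').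
    by rewrite scalerBr opprD addrACA.
  rewrite (le_lt_trans (ler_normD _ _))// (splitr e) ler_ltD// normrZ.
  rewrite (le_trans (y := (`|k| + 1) * `|x - u|)) ?ler_wpM2r ?lerDl//.
  by rewrite mulrC -ler_pdivlMr// ltW.
by exists (k *: w + w'); rewrite Ll L'l; split; exact: est.
Qed.

Lemma graph_closure_norm L L' y z : (forall w, `|L' w| = `|L w|) ->
  graph_closure L L' y z -> `|z| = `|y|.
Proof.
move=> LL' yz.
have lt_eps e : 0 < e -> `| `|z| - `|y| | < e.
  move=> e0; have [w [yw zw]] := yz _ (divr_gt0 e0 (ltr0n _ 2)).
  have -> : `|z| - `|y| = (`|z| - `|L' w|) - (`|y| - `|L w|).
    by rewrite LL' opprB addrA addrNK.
  rewrite (splitr e) (le_lt_trans (ler_normB _ _))// ltrD//.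
    exact: le_lt_trans (ler_dist_dist _ _) zw.
  exact: le_lt_trans (ler_dist_dist _ _) yw.
apply/eqP; rewrite -subr_eq0 -normr_le0; apply: contrapT => /negP N0.
(* A positive gap, taken as its own [e], would be smaller than itself. *)
suff /lt_eps : 0 < `| `|z| - `|y| | by rewrite ltxx.
by rewrite normr_gt0 -normr_le0.
Qed.

Lemma graph_closure_ex L L' y : linear L -> linear L' ->
  (forall w, `|L' w| = `|L w|) -> dense (range L) ->
  exists z, graph_closure L L' y z.
Proof.
move=> Ll L'l LL' Ld.
(* The neighbourhoods of [y] are pulled back along [L] and pushed along [L']. Density of the range
   of [L] makes [F] proper, equality of norms makes it Cauchy, and its limit is the required [z]. *)
pose F := filter_from (nbhs y) (fun N => L' @` (L @^-1` N)).
have FF : ProperFilter F.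
  apply: filter_from_proper => [|N yN].
    apply: filter_from_filter; first by exists setT; exact: filterT.
    move=> M N yM yN; exists (M `&` N); first exact: filterI.
    by move=> _ [w [Mw Nw] <-]; split; exists w.
  have /nbhs_ballP[e /= e0 yeN] := yN.
  have [w yw] := (dense_rangeP L).1 Ld y e e0.
  by exists (L' w), w => //; apply: yeN; rewrite -ball_normE.
have : cvg F.
  apply: cauchy_cvg; apply: cauchy_exP => e e0.
  have e20 : 0 < e / 2 by rewrite divr_gt0.
  have [w0 yw0] := (dense_rangeP L).1 Ld y _ e20.
  exists (L' w0), (ball y (e / 2)); first exact: nbhsx_ballx.
  move=> _ [w + <-]; rewrite -!ball_normE/= => yw.
  rewrite -(linear_mapB L'l) LL' (linear_mapB Ll).
  rewrite (splitr e) (le_lt_trans (ler_distD y _ _))// ltrD// distrC//.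
move=> Fz; exists (lim F) => e e0.
(* A single [w] must serve both estimates, so [L w] is taken in [N], for closeness of [L' w] to the
   limit, and in [ball y e]. *)
have [N yN NF] : F (ball (lim F) e) by apply: Fz; exact: nbhsx_ballx.
have [d /= d0 ydN] : exists2 d : K, 0 < d & ball y d `<=` N `&` ball y e.
  by apply/nbhs_ballP; apply: filterI => //; exact: nbhsx_ballx.
have [w yw] := (dense_rangeP L).1 Ld y d d0.
have [Nw] : (N `&` ball y e) (L w) by apply: ydN; rewrite -ball_normE.
rewrite -ball_normE => yw'; exists w; split => //.
by have := NF (L' w) (ex_intro2 _ _ w Nw erefl); rewrite -ball_normE.
Qed.

End ClosedGraph.

(** * Extension of isometries to unitaries *)

Section HilbertExtension.
Context {R : realType}.
Implicit Types H : hilbertType R.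

Lemma norm_eq_inner H1 H2 (x : H1) (y : H2) :
  inner x x = inner y y -> `|x| = `|y|.
Proof.
rewrite -!normE_inner => /eqP; rewrite eqrXn2 ?normr_ge0// => /eqP//.
Qed.

Lemma linear_isometry_inner H1 H2 (U : H1 -> H2) : linear U ->
  (forall x, `|U x| = `|x|) -> forall x y, inner (U x) (U y) = inner x y.
Proof.
move=> Ul Un.
have Ui x : inner (U x) (U x) = inner x x by rewrite -!normE_inner Un.
have re x y : inner (U x) (U y) + inner (U y) (U x) = inner x y + inner y x.
  have := Ui (x + y); rewrite (linear_mapD Ul) !(linearDl, linearDr) /=.
  rewrite !Ui; set a := inner (U x) _; set b := inner (U y) _.
  set c := inner x y; set d := inner y x.
  by rewrite -!addrA => /addrI; rewrite !addrA => /addIr.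
move=> x y.
(* Polarization: replacing [y] by ['i *: y] and dividing by ['i] flips the sign of the first term on
   each side; subtracting the two identities leaves twice the inner products. *)
have := re x ('i *: y).
rewrite (linear_mapZ Ul) !linearZl_LR !linearZr_LR /= conjCi.
rewrite !mulNr -!mulrN -!mulrDr => /(mulfI (neq0Ci _)) im.
have half (a b c d : R[i]) : a + b = c + d -> - a + b = - c + d -> a = c.
  move=> abcd; move/(congr2 (fun u v => u - v) abcd).
  rewrite [- (- a + b)]opprD opprK [- (- c + d)]opprD opprK.
  rewrite addrACA subrr addr0 [RHS]addrACA subrr addr0 -!mulr2n.
  exact: (@pmulrnI _ 2).
exact: half (re x y) im.
Qed.

(** [U y] is the partner of [y] in the graph closure. It is unique because the norm identity applies
    to differences of pairs, and [U] is onto because [L] and [L'] can be exchanged. *)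
Lemma unitary_extension (W : lmodType R[i]) (H : hilbertType R)
    (L L' : W -> H) : linear L -> linear L' ->
  (forall w, `|L' w| = `|L w|) -> dense (range L) -> dense (range L') ->
  exists2 U : H -> H, unitary U & forall w, U (L w) = L' w.
Proof.
move=> Ll L'l LL' Ld L'd.
have [U UL] := choice (fun y => graph_closure_ex y Ll L'l LL' Ld).
have graph_closure_fun y z z' :
    graph_closure L L' y z -> graph_closure L L' y z' -> z = z'.
  move=> yz yz'; apply/eqP; rewrite -subr_eq0 -normr_eq0.
  have := graph_closure_norm LL' (graph_closure_lin (-1) Ll L'l yz' yz).
  by rewrite !scaleN1r addNr normr0 addrC => ->.
have Ul : linear U.
  by move=> k x y; apply: (graph_closure_fun (k *: x + y)) => //;
    exact: graph_closure_lin.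
exists U => [|w]; last first.
  exact: graph_closure_fun (UL _) (graph_closure_id _ _ _).
split=> // [|z].
  by apply: linear_isometry_inner => // y; exact: graph_closure_norm LL' (UL y).
have [y zy] := graph_closure_ex z L'l Ll (fun w => esym (LL' w)) L'd.
by exists y; exact: graph_closure_fun (UL y) (graph_closure_sym zy).
Qed.

End HilbertExtension.

(** * The map V on Lam(A) (x) Lam(A) *)

Section RightRegularIsometry.
Context {R : realType} {A : starAlgType R[i]} (G : multHopf A).
Context (psi : {scalar A}) (psi_int : right_integral G psi).
Context (H : hilbertType R) (Lam : A -> H) (H_compl : is_completion psi Lam).
Context (HH : hilbertType R) (ot : H -> H -> HH).
Context (HH_tens : is_hilbert_tensor ot).

Let T (w : tensor A A) : HH := Lam2 Lam ot w.

Lemma Lam2_bilinear : bilinear_map (fun x x' => ot (Lam x) (Lam x')).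
Proof.
have [otl otr] := hilbert_tensor_bilinear HH_tens.
have Ll := completion_linear H_compl.
by split=> [b|a] k x y; rewrite Ll; [exact: otl|exact: otr].
Qed.

Lemma Lam2_linear : linear T.
Proof. exact/tlift_linear/Lam2_bilinear. Qed.

Lemma Lam2E x x' : T (x \ot x') = ot (Lam x) (Lam x').
Proof. exact/tlift_tens/bilinear_balanced/Lam2_bilinear. Qed.

(** This is (psi (x) psi)(v^* u), with the first leg evaluated first since right invariance acts
    there. *)
Lemma inner_Lam2 u v : inner (T u) (T v) = psi (slice_l psi (star v ** u)).
Proof.
have T0 := linear_map0 Lam2_linear; have TD := linear_mapD Lam2_linear.
have sl := slice_l_linear psi.
move: u v; apply: tensor_ind => [a b||u u' IH IH'] v.
- move: v; apply: tensor_ind => [c d||v v' IH IH'].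
  + rewrite !Lam2E (hilbert_tensor_inner HH_tens).
    rewrite !(completion_inner H_compl) [star (c \ot d)]tstarE [_ ** (a \ot b)]tmulE.
    by rewrite slice_lE linearZ.
  + rewrite T0 linear0r [star 0]tstar0 [0 ** _]tmulr0.
    by rewrite (linear_map0 sl) linear0.
  + rewrite TD linearDr /= IH IH' [star (_ + _)]starD [(_ + _) ** _]tmulDl.
    by rewrite (linear_mapD sl) linearD.
- rewrite T0 linear0l [_ ** 0]tmul0r.
  by rewrite (linear_map0 sl) linear0.
- rewrite TD linearDl /= IH IH' [_ ** (_ + _)]tmulDr.
  by rewrite (linear_mapD sl) linearD.
Qed.

(** For [u = a \ot b] and [v = c \ot d] both sides are psi(c^* a) psi(d^* b), by
    [slice_star_canL]. *)
Lemma inner_Lam2_canL u v :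
  inner (T (canL G u)) (T (canL G v)) = inner (T u) (T v).
Proof.
have Tl := Lam2_linear.
have TGl := linear_comp Lam2_linear (@canL_linear _ _ G).
move: u v; apply: tensor_ind => [a b||u u' IH IH'] v.
- move: v; apply: tensor_ind => [c d||v v' IH IH'].
  + rewrite !inner_Lam2 slice_star_canL// [star (c \ot d)]tstarE.
    rewrite [_ ** (a \ot b)]tmulE slice_lE !linearZ /=.
    by rewrite (linear_mapZ (amull_linear _)) linearZ.
  + by rewrite (linear_map0 Tl) (linear_map0 TGl) !linear0r.
  + by rewrite (linear_mapD Tl) (linear_mapD TGl) !linearDr /= IH IH'.
- by rewrite (linear_map0 Tl) (linear_map0 TGl) !linear0l.
- by rewrite (linear_mapD Tl) (linear_mapD TGl) !linearDl /= IH IH'.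
Qed.

Lemma norm_Lam2_canL w : `|T (canL G w)| = `|T w|.
Proof. exact/norm_eq_inner/inner_Lam2_canL. Qed.

(** Isometry makes V well defined on the range of [T] without an appeal to injectivity of [T]. *)
Lemma Lam2_canL_eq u v : T u = T v -> T (canL G u) = T (canL G v).
Proof.
move=> uv; apply/eqP; rewrite -subr_eq0 -normr_eq0.
rewrite -(linear_mapB Lam2_linear) -(linear_mapB (@canL_linear _ _ G)).
by rewrite norm_Lam2_canL (linear_mapB Lam2_linear) uv subrr normr0.
Qed.

Lemma norm_hilbert_tensor x y : `|ot x y| = `|x| * `|y|.
Proof.
apply/eqP; rewrite -(@eqrXn2 _ 2) ?mulr_ge0// exprMn !normE_inner.
by rewrite (hilbert_tensor_inner HH_tens).
Qed.

Lemma Lam2_dense : dense (range T).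
Proof.
have [otl otr] := hilbert_tensor_bilinear HH_tens.
have /dense_rangeP Ld := completion_dense H_compl.
have approx_ot x y (e : R[i]) : 0 < e -> exists w, `|ot x y - T w| < e.
  move=> e0; have e20 : 0 < e / 2 by rewrite divr_gt0.
  have pos (z : H) : 0 < `|z| + 1 by rewrite ltr_wpDl.
  have small (d z : H) : `|d| < e / 2 / (`|z| + 1) -> `|d| * `|z| < e / 2.
    rewrite ltr_pdivlMr//; apply: le_lt_trans.
    by rewrite ler_wpM2l// lerDl.
  have [a xa] := Ld x _ (divr_gt0 e20 (pos y)).
  (* The factors are replaced in turn, so the tolerance for [y] depends on the [a] already
     chosen. *)
  have [b yb] := Ld y _ (divr_gt0 e20 (pos (Lam a))).
  exists (a \ot b); rewrite Lam2E.
  have -> : ot x y - ot (Lam a) (Lam b) =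
      ot (x - Lam a) y + ot (Lam a) (y - Lam b).
    by rewrite (linear_mapB (otl _)) (linear_mapB (otr _)) addrA addrNK.
  rewrite (le_lt_trans (ler_normD _ _))// !norm_hilbert_tensor (splitr e).
  by apply: ltrD; [|rewrite mulrC]; exact: small.
have approx t : forall e : R[i], 0 < e -> exists w, `|tlift ot t - T w| < e.
  have fB := bilinear_balanced (hilbert_tensor_bilinear HH_tens).
  move: t; apply: tensor_ind => [x y e e0|e e0|t t' IH IH' e e0].
  - by rewrite tlift_tens//; exact: approx_ot.
  - exists 0; rewrite (linear_map0 Lam2_linear) subr0.
    by rewrite (linear_map0 (tlift_linear (conj otl otr))) normr0.
  - have e20 : 0 < e / 2 by rewrite divr_gt0.
    have [[w tw] [w' tw']] := (IH _ e20, IH' _ e20).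
    exists (w + w'); rewrite tliftD// (linear_mapD Lam2_linear) opprD addrACA.
    by rewrite (splitr e) (le_lt_trans (ler_normD _ _))// ltrD.
apply/dense_rangeP => y e e0; have e20 : 0 < e / 2 by rewrite divr_gt0.
have /dense_rangeP td := hilbert_tensor_dense HH_tens.
have [t yt] := td y _ e20; have [w tw] := approx t _ e20; exists w.
by rewrite (splitr e) (le_lt_trans (ler_distD (tlift ot t) _ _))// ltrD.
Qed.

Lemma is_V_ex : exists V, is_V G Lam ot V.
Proof.
have Vex u : exists v, forall w, T w = u -> T (canL G w) = v.
  have [[w wu]|Nu] := pselect (exists w, T w = u).
    by exists (T (canL G w)) => w' w'u; apply: Lam2_canL_eq; rewrite w'u.
  (* Outside the range of [T] the value 0 is arbitrary. *)
  by exists 0 => w wu; case: Nu; exists w.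
have [V VE] := choice Vex; exists V; split=> [k _ _ [u _ <-] [v _ <-]|x x'].
  rewrite -(VE _ u erefl) -(VE _ v erefl).
  rewrite -(VE _ (k *: u + v)); last exact: Lam2_linear.
  by rewrite canL_linear; exact: Lam2_linear.
by rewrite -(VE _ (x \ot x'))// Lam2E.
Qed.

Lemma is_V_Lam2 V : is_V G Lam ot V -> forall w, V (T w) = T (canL G w).
Proof.
move=> [Vl VE].
have domT w : dom_V Lam ot (T w) by exists w.
have TGl := linear_comp Lam2_linear (@canL_linear _ _ G).
have VD w w' : V (T w + T w') = V (T w) + V (T w').
  by rewrite -[T w in LHS]scale1r Vl// scale1r.
apply: tensor_ind => [a b||w w' IH IH'].
- by rewrite Lam2E VE.
(* Additivity on [dom_V] forces V to vanish at 0. *)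
- apply: (addrI (V (T 0))); rewrite -VD.
  by rewrite (linear_map0 TGl) (linear_map0 Lam2_linear) !addr0.
- by rewrite (linear_mapD Lam2_linear) VD IH IH' (linear_mapD TGl).
Qed.

End RightRegularIsometry.

(** * Isometry and unitary extension of V *)

Theorem proposition2p5 (R : realType) (A : starAlgType R[i]) (G : multHopf A)
    (left_int : exists phi : {scalar A},
       left_integral G phi /\ positive_functional phi)
    (psi : {scalar A}) (psi_int : right_integral G psi)
    (psi_pos : positive_functional psi)
    (H : hilbertType R) (Lam : A -> H) (H_compl : is_completion psi Lam)
    (HH : hilbertType R) (ot : H -> H -> HH) (HH_tens : is_hilbert_tensor ot) :
  (exists V : HH -> HH, is_V G Lam ot V) /\
  (forall V : HH -> HH, is_V G Lam ot V ->
     (forall u, dom_V Lam ot u -> `|V u| = `|u|) /\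
     (exists U : HH -> HH,
        unitary U /\ (forall u, dom_V Lam ot u -> U u = V u))).
Proof.
split; first exact: (is_V_ex psi_int H_compl HH_tens).
move=> V isV; have VE := is_V_Lam2 H_compl HH_tens isV.
have isoV := norm_Lam2_canL psi_int H_compl HH_tens.
split=> [_ [w _ <-]|]; first by rewrite VE isoV.
have Tl := Lam2_linear H_compl HH_tens.
have Td := Lam2_dense H_compl HH_tens.
have [|//||U Uu UE] := unitary_extension Tl _ isoV.
- exact: linear_comp Tl (@canL_linear _ _ G).
(* Surjectivity of [canL] gives both maps the same range, so density carries over. *)
- have [g canLK gK] := canL_bij G.
  suff <- : range (Lam2 Lam ot) = range (fun w => Lam2 Lam ot (canL G w)) by [].
  apply/seteqP; split=> _ [w _ <-]; last by exists (canL G w).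
  by exists (g w); rewrite ?gK.
by exists U; split=> // _ [w _ <-]; rewrite UE VE.
Qed.
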